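(* Let $P(\lambda)=\sum_{i=0}^{m}A_i\lambda^i$ be a quaternion matrix polynomial all of whose coefficients $A_0,A_1,\dots,A_m\in M_n(\mathbb{H})$ are unitary matrices, and let $\lambda_0\in\mathbb{H}$ be a right eigenvalue of $P(\lambda)$. Then $\frac{1}{2}<|\lambda_0|<2$.
   Context: $\mathbb{H}$ is the set of real quaternions, $|q|=\sqrt{a_0^2+a_1^2+a_2^2+a_3^2}$ for $q=a_0+a_1i+a_2j+a_3k$, and $M_n(\mathbb{H})$ is the set of $n\times n$ matrices over $\mathbb{H}$. A matrix $A\in M_n(\mathbb{H})$ is unitary if $AA^*=I=A^*A$, where $A^*$ is the conjugate transpose. A (right) quaternion matrix polynomial of size $n$ and degree $m$ is a map $P:\mathbb{H}\to M_n(\mathbb{H})$, $P(\lambda)=\sum_{i=0}^m A_i\lambda^i$ with $A_i\in M_n(\mathbb{H})$. A quaternion $\lambda_0$ is a right eigenvalue of $P(\lambda)$ if $\sum_{i=0}^m A_i x\lambda_0^i=0$ for some nonzero vector $x\in\mathbb{H}^n$. *)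

(* Defs.v *)
From HB Require Import structures.
From mathcomp Require Import all_boot all_order all_algebra.
From mathcomp Require Import ring.
From mathcomp Require Import reals.
Set Implicit Arguments.
Unset Strict Implicit.
Unset Printing Implicit Defensive.

Import Order.TTheory GRing.Theory Num.Theory.
Local Open Scope ring_scope.

(* [Quaternion a0 a1 a2 a3] is a0 + a1 i + a2 j + a3 k. *)
Record quaternion (R : Type) := Quaternion {
  qre : R;
  qi : R;
  qj : R;
  qk : R
}.

Section QuaternionRing.
Variable R : rcfType.
Implicit Types p q : quaternion R.

Definition quaternion_tuple q := (qre q, qi q, qj q, qk q).
Definition tuple_quaternion (t : R * R * R * R) :=
  let: (a, b, c, d) := t in Quaternion a b c d.

Lemma quaternion_tupleK : cancel quaternion_tuple tuple_quaternion.
Proof. by case. Qed.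

HB.instance Definition _ :=
  Choice.copy (quaternion R) (can_type quaternion_tupleK).

Definition quat_add p q :=
  Quaternion (qre p + qre q) (qi p + qi q) (qj p + qj q) (qk p + qk q).

Definition quat_opp q := Quaternion (- qre q) (- qi q) (- qj q) (- qk q).

(* Hamilton product: i^2 = j^2 = k^2 = ijk = -1. *)
Definition quat_mul p q :=
  Quaternion
    (qre p * qre q - qi p * qi q - qj p * qj q - qk p * qk q)
    (qre p * qi q + qi p * qre q + qj p * qk q - qk p * qj q)
    (qre p * qj q - qi p * qk q + qj p * qre q + qk p * qi q)
    (qre p * qk q + qi p * qj q - qj p * qi q + qk p * qre q).

Let quat_zero : quaternion R := Quaternion 0 0 0 0.
Let quat_one : quaternion R := Quaternion 1 0 0 0.

Lemma quat_addA : associative quat_add.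
Proof.
by move=> [a b c d] [e f g h] [k l m n]; congr Quaternion => /=; ring.
Qed.

Lemma quat_addC : commutative quat_add.
Proof. by move=> [a b c d] [e f g h]; congr Quaternion => /=; ring. Qed.

Lemma quat_add0l : left_id quat_zero quat_add.
Proof. by move=> [a b c d]; congr Quaternion => /=; ring. Qed.

Lemma quat_addNl : left_inverse quat_zero quat_opp quat_add.
Proof. by move=> [a b c d]; congr Quaternion => /=; ring. Qed.

HB.instance Definition _ :=
  GRing.isZmodule.Build (quaternion R) quat_addA quat_addC quat_add0l quat_addNl.

Lemma quat_mulA : associative quat_mul.
Proof.
by move=> [a b c d] [e f g h] [k l m n]; congr Quaternion => /=; ring.
Qed.

Lemma quat_mul1l : left_id quat_one quat_mul.
Proof. by move=> [a b c d]; congr Quaternion => /=; ring. Qed.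

Lemma quat_mul1r : right_id quat_one quat_mul.
Proof. by move=> [a b c d]; congr Quaternion => /=; ring. Qed.

Lemma quat_mulDl : left_distributive quat_mul quat_add.
Proof.
by move=> [a b c d] [e f g h] [k l m n]; congr Quaternion => /=; ring.
Qed.

Lemma quat_mulDr : right_distributive quat_mul quat_add.
Proof.
by move=> [a b c d] [e f g h] [k l m n]; congr Quaternion => /=; ring.
Qed.

Lemma quat_one_neq0 : quat_one != 0.
Proof. by apply/eqP => -[] /eqP; rewrite oner_eq0. Qed.

HB.instance Definition _ := GRing.Zmodule_isNzRing.Build (quaternion R)
  quat_mulA quat_mul1l quat_mul1r quat_mulDl quat_mulDr quat_one_neq0.

Definition quat_conj q := Quaternion (qre q) (- qi q) (- qj q) (- qk q).

Definition quat_norm q : R :=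
  Num.sqrt (qre q ^+ 2 + qi q ^+ 2 + qj q ^+ 2 + qk q ^+ 2).

End QuaternionRing.

Section QuaternionMatrix.
Variable R : rcfType.

Definition conj_trmx m n (A : 'M[quaternion R]_(m, n)) :
  'M[quaternion R]_(n, m) := map_mx (@quat_conj R) A^T.

Definition qunitary n (A : 'M[quaternion R]_n) : Prop :=
  A *m conj_trmx A = 1%:M /\ conj_trmx A *m A = 1%:M.

(* Right multiplication by a scalar; [*:%R] on matrices multiplies on the
   left, which is different since quaternions do not commute. *)
Definition rscalemx m n (A : 'M[quaternion R]_(m, n)) (q : quaternion R) :
  'M[quaternion R]_(m, n) := map_mx (fun a => a * q) A.

(* The polynomial sum_(i <= m) A_i lambda^i is given by its coefficients. *)
Definition qmxpoly n m := 'I_m.+1 -> 'M[quaternion R]_n.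

Definition qmxpoly_eval n m (P : qmxpoly n m) (l : quaternion R) :
  'M[quaternion R]_n := \sum_(i < m.+1) rscalemx (P i) (l ^+ i).

(* The power of [l] stands to the right of [x], so this is not
   [qmxpoly_eval P l *m x = 0]. *)
Definition right_eigenvalue n m (P : qmxpoly n m) (l : quaternion R) : Prop :=
  exists x : 'cV[quaternion R]_n,
    x != 0 /\ \sum_(i < m.+1) rscalemx (P i *m x) (l ^+ i) = 0.

End QuaternionMatrix.

(* Main.v *)
(** A unitary matrix preserves the Euclidean norm of [H^n], and right
    multiplication by [l] scales it by [r = |l|].  Hence an eigenvector [x]
    with eigenvalue [l] gives vectors of norms [r^i |x|], [i <= m], that sum
    to zero, and the triangle inequality bounds each [r^k] by the sum of the
    other powers.  Taking [k = m] and [k = 0] and comparing with the geometric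
    series of ratio [2] and [1/2] excludes [r >= 2] and [r <= 1/2]. *)
Require Import Defs.
From HB Require Import structures.
From mathcomp Require Import all_boot all_order all_algebra.
From mathcomp Require Import ring lra.
From mathcomp Require Import reals.
Import Order.TTheory GRing.Theory Num.Theory.
Local Open Scope ring_scope.

Section QuaternionVectorNorm.
Set Implicit Arguments.
Unset Strict Implicit.
Variable R : rcfType.
Implicit Types p q l : quaternion R.

Definition quat_dot p q : R :=
  qre p * qre q + qi p * qi q + qj p * qj q + qk p * qk q.

Lemma quat_dot_ge0 p : 0 <= quat_dot p p.
Proof. by rewrite /quat_dot; case: p => a b c d /=; nra. Qed.

Lemma quat_dot_eq0 p : quat_dot p p = 0 -> p = 0.
Proof.
rewrite /quat_dot; case: p => a b c d /= h.
have [ha hb hc hd] : [/\ a ^+ 2 = 0, b ^+ 2 = 0, c ^+ 2 = 0 & d ^+ 2 = 0].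
  have := (sqr_ge0 a, sqr_ge0 b, sqr_ge0 c, sqr_ge0 d).
  by move=> [[[]]]; split; lra.
by congr Quaternion; apply/eqP; rewrite -sqrf_eq0; apply/eqP.
Qed.

Lemma quat_normE q : quat_norm q = Num.sqrt (quat_dot q q).
Proof. by rewrite /quat_norm /quat_dot !expr2. Qed.

(** Right multiplication by [l] is a similarity of R^4. The case [p = q] is Euler's four-square
    identity, which makes the norm multiplicative. *)
Lemma quat_dotMM p q l :
  quat_dot (p * l) (q * l) = quat_dot p q * quat_dot l l.
Proof.
by rewrite /quat_dot; case: p q l => [a b c d] [e f g h] [s t u v] /=; ring.
Qed.

Lemma quat_norm1 : quat_norm (1 : quaternion R) = 1.
Proof. by rewrite quat_normE /quat_dot /= !mul0r mul1r !addr0 sqrtr1. Qed.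

Lemma quat_normM p q : quat_norm (p * q) = quat_norm p * quat_norm q.
Proof. by rewrite !quat_normE quat_dotMM sqrtrM ?quat_dot_ge0. Qed.

Lemma quat_normX q k : quat_norm (q ^+ k) = quat_norm q ^+ k.
Proof.
by elim: k => [|k IHk]; rewrite ?expr0 ?quat_norm1 // !exprS quat_normM IHk.
Qed.

Lemma quat_conj_is_zmod_morphism : zmod_morphism (@quat_conj R).
Proof. by move=> [a b c d] [e f g h]; congr Quaternion => /=; ring. Qed.

HB.instance Definition _ := GRing.isZmodMorphism.Build
  (quaternion R) (quaternion R) (@quat_conj R) quat_conj_is_zmod_morphism.

Lemma quat_re_is_zmod_morphism : zmod_morphism (@qre R).
Proof. by case=> ? ? ? ? []. Qed.

HB.instance Definition _ := GRing.isZmodMorphism.Build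
  (quaternion R) R (@qre R) quat_re_is_zmod_morphism.

Lemma quat_conjM p q : quat_conj (p * q) = quat_conj q * quat_conj p.
Proof.
by case: p q => [a b c d] [e f g h]; congr Quaternion => /=; ring.
Qed.

Lemma qre_conj_mul p q : qre (quat_conj p * q) = quat_dot p q.
Proof. by rewrite /quat_dot /=; ring. Qed.

(** Transposition alone does not reverse products over a noncommutative ring; it does here because
    [quat_conj] swaps the factors of each entry product. *)
Lemma conj_trmx_mul m n k (A : 'M[quaternion R]_(m, n))
    (B : 'M[quaternion R]_(n, k)) :
  conj_trmx (A *m B) = conj_trmx B *m conj_trmx A.
Proof.
apply/matrixP => i j; rewrite !mxE raddf_sum.
by apply: eq_bigr => s _; rewrite !mxE; apply: quat_conjM.
Qed.

Section Vectors.
Variable n : nat.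
Implicit Types x y : 'cV[quaternion R]_n.

Definition qvec_dot x y : R := \sum_i quat_dot (x i 0) (y i 0).

Definition qvec_norm x : R := Num.sqrt (qvec_dot x x).

Lemma qvec_dot_ge0 x : 0 <= qvec_dot x x.
Proof. by apply: sumr_ge0 => i _; apply: quat_dot_ge0. Qed.

Lemma qvec_norm_ge0 x : 0 <= qvec_norm x.
Proof. exact: sqrtr_ge0. Qed.

Lemma sqr_qvec_norm x : qvec_norm x ^+ 2 = qvec_dot x x.
Proof. by rewrite sqr_sqrtr ?qvec_dot_ge0. Qed.

Lemma qvec_norm_eq0 x : qvec_norm x = 0 -> x = 0.
Proof.
move=> x0; have /eqP := sqr_qvec_norm x.
rewrite x0 expr0n eq_sym psumr_eq0 => [/allP h|i _]; last exact: quat_dot_ge0.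
apply/matrixP => i j; rewrite (ord1 j) mxE; apply: quat_dot_eq0.
by apply/eqP; apply: h; rewrite mem_index_enum.
Qed.

Lemma qvec_norm0 : qvec_norm 0 = 0.
Proof.
rewrite /qvec_norm /qvec_dot big1 ?sqrtr0 // => i _.
by rewrite mxE /quat_dot /= !mul0r !addr0.
Qed.

Lemma qvec_normN x : qvec_norm (- x) = qvec_norm x.
Proof.
congr Num.sqrt; apply: eq_bigr => i _; rewrite mxE /quat_dot /=; ring.
Qed.

(* Cauchy-Schwarz, from [0 <= |b x - a y|^2] with [a = |x|] and [b = |y|]. *)
Lemma qvec_dot_le x y : qvec_dot x y <= qvec_norm x * qvec_norm y.
Proof.
set a := qvec_norm x; set b := qvec_norm y.
(* The last step cancels [a * b], so zero vectors are treated apart. *)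
have [a0|a_neq0] := eqVneq a 0.
  rewrite a0 mul0r (qvec_norm_eq0 a0) /qvec_dot big1 // => i _.
  by rewrite mxE /quat_dot /= !mul0r !addr0.
have [b0|b_neq0] := eqVneq b 0.
  rewrite b0 mulr0 (qvec_norm_eq0 b0) /qvec_dot big1 // => i _.
  by rewrite mxE /quat_dot /= !mulr0 !addr0.
have ab_gt0 : 0 < a * b.
  by rewrite mulr_gt0 // lt_neqAle eq_sym qvec_norm_ge0 ?a_neq0 ?b_neq0.
have h : 2 * (a * b) * qvec_dot x y 
      <= b ^+ 2 * qvec_dot x x + a ^+ 2 * qvec_dot y y.
  rewrite /qvec_dot !mulr_sumr -big_split /=.
  apply: ler_sum => i _; rewrite /quat_dot.
  case: (x i 0) (y i 0) => [x0 x1 x2 x3] [y0 y1 y2 y3] /=; rewrite -subr_ge0.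
  rewrite [leRHS](_ : _ = (b * x0 - a * y0) ^+ 2 + (b * x1 - a * y1) ^+ 2
    + (b * x2 - a * y2) ^+ 2 + (b * x3 - a * y3) ^+ 2); last by ring.
  by rewrite !addr_ge0 ?sqr_ge0.
rewrite -!sqr_qvec_norm -/a -/b in h.
by rewrite -(ler_pM2l ab_gt0); lra.
Qed.

Lemma ler_qvec_normD x y : qvec_norm (x + y) <= qvec_norm x + qvec_norm y.
Proof.
(* Both sides are nonnegative, so their squares are compared; after expansion only Cauchy-Schwarz
   remains. *)
rewrite -(ler_pXn2r (ltn0Sn 1)) ?nnegrE ?addr_ge0 ?qvec_norm_ge0 //.
rewrite sqrrD !sqr_qvec_norm.
have -> : qvec_dot (x + y) (x + y)
    = qvec_dot x x + qvec_dot x y *+ 2 + qvec_dot y y.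
  rewrite /qvec_dot -sumrMnl -!big_split /=; apply: eq_bigr => i _.
  by rewrite mxE /quat_dot /=; ring.
by rewrite lerD2r lerD2l lerMn2r qvec_dot_le orbT.
Qed.

Lemma ler_qvec_norm_sum (I : Type) (r : seq I) (P : pred I)
    (F : I -> 'cV[quaternion R]_n) :
  qvec_norm (\sum_(i <- r | P i) F i) <= \sum_(i <- r | P i) qvec_norm (F i).
Proof.
elim/big_ind2: _ => [|x a y b xa yb|//]; first by rewrite qvec_norm0.
by apply: le_trans (ler_qvec_normD _ _) _; apply: lerD.
Qed.

Lemma qvec_norm_rscale x q :
  qvec_norm (rscalemx x q) = qvec_norm x * quat_norm q.
Proof.
rewrite quat_normE -sqrtrM ?qvec_dot_ge0 //; congr Num.sqrt.
by rewrite mulr_suml; apply: eq_bigr => i _; rewrite !mxE quat_dotMM.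
Qed.

(** In this matrix form, associativity brings [U^* U] together inside the product for [U x], and
    unitarity removes it. *)
Lemma qvec_dotE x y : qvec_dot x y = qre ((conj_trmx x *m y) 0 0).
Proof.
rewrite mxE raddf_sum; apply: eq_bigr => i _.
by rewrite !mxE; apply/esym/qre_conj_mul.
Qed.

Lemma qvec_norm_unitary (U : 'M[quaternion R]_n) x :
  qunitary U -> qvec_norm (U *m x) = qvec_norm x.
Proof.
case=> _ UU; rewrite /qvec_norm !qvec_dotE conj_trmx_mul mulmxA.
by rewrite -(mulmxA (conj_trmx x)) UU mulmx1.
Qed.

End Vectors.

Lemma unitary_eigenvalue_norm_le n m (A : qmxpoly R n m) l (k : 'I_m.+1) :
  (forall i, qunitary (A i)) -> right_eigenvalue A l ->
  quat_norm l ^+ k <= \sum_(i < m.+1 | i != k) quat_norm l ^+ i.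
Proof.
move=> hA [x [x_neq0 hx]].
have x_gt0 : 0 < qvec_norm x.
  rewrite lt_neqAle qvec_norm_ge0 andbT eq_sym.
  by apply: contra x_neq0 => /eqP /qvec_norm_eq0 ->.
have nE i : qvec_norm (rscalemx (A i *m x) (l ^+ i))
    = qvec_norm x * quat_norm l ^+ i.
  by rewrite qvec_norm_rscale qvec_norm_unitary // quat_normX.
(* After scaling by [|x| > 0], the left side is the norm of the [k]-th term of the eigenvalue
   equation, hence of minus the sum of the others. *)
rewrite -(ler_pM2l x_gt0) mulr_sumr -nE.
move: hx; rewrite (bigD1 k) //= => /eqP; rewrite addr_eq0 => /eqP ->.
rewrite qvec_normN; apply: le_trans (ler_qvec_norm_sum _ _ _) _.
by apply: ler_sum => i _; rewrite nE.
Qed.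

End QuaternionVectorNorm.

(** By induction: adding [r ^+ m] to the sum gives less than [2 * r ^+ m], which is at most
    [r ^+ m.+1]. *)
Lemma sum_geometric_lt_expr (R : realFieldType) (r : R) m :
  2 <= r -> \sum_(i < m) r ^+ i < r ^+ m.
Proof.
move=> r_ge2; elim: m => [|m IHm]; first by rewrite big_ord0 expr0.
have rm_gt0 : 0 < r ^+ m by apply: exprn_gt0; lra.
have := ler_wpM2r (ltW rm_gt0) r_ge2.
by rewrite big_ord_recr /= exprS; lra.
Qed.

Lemma sum_geometric_lt1 (R : realFieldType) (r : R) m :
  0 <= r -> r <= 1 / 2 -> \sum_(i < m) r ^+ i.+1 < 1.
Proof.
move=> r_ge0 r_le; elim: m => [|m IHm]; first by rewrite big_ord0.
(* Splitting off the first term gives [r + r * S], with [S < 1] the shorter sum; this is at most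
   [1 / 2 + S / 2 < 1]. *)
rewrite big_ord_recl expr1.
under eq_bigr => i _ do rewrite lift0 exprS.
rewrite -mulr_sumr.
have S_ge0 : 0 <= \sum_(i < m) r ^+ i.+1.
  by apply: sumr_ge0 => i _; apply: exprn_ge0.
by have := ler_wpM2r S_ge0 r_le; lra.
Qed.

Theorem theorem3p8 (R : realType) (n m : nat) (A : qmxpoly R n m)
    (hA : forall i : 'I_m.+1, qunitary (A i))
    (lambda0 : quaternion R) (hlambda0 : right_eigenvalue A lambda0) :
  1 / 2 < quat_norm lambda0 < 2.
Proof.
have hle k := unitary_eigenvalue_norm_le k hA hlambda0.
have r_ge0 : 0 <= quat_norm lambda0 by apply: sqrtr_ge0.
apply/andP; split; rewrite ltNge; apply/negP => hr.
  (* For [k = 0] the excluded index contributes 0 and the others shift to exponents [i.+1]. *)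
  have := hle ord0; rewrite big_mkcond big_ord_recl /= add0r expr0.
  by rewrite leNgt sum_geometric_lt1.
have := hle ord_max; rewrite big_mkcond big_ord_recr /= eqxx addr0.
(* For [k = m] the guard [i != m] holds at every remaining index, as [i < m]. *)
rewrite (eq_bigr (fun i : 'I_m => quat_norm lambda0 ^+ i)) => [|i _].
  by rewrite leNgt sum_geometric_lt_expr.
by rewrite ifT // -val_eqE /= ltn_eqF.
Qed.
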